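(* Let $k\ge 2$, $c>0$, and for $h=1,\dots,k$ let $m_h>0$, $q_h\in\mathbb{R}$. Let $\boldsymbol{\alpha}^{\perp}\in C^2(\mathbb{R},\mathbb{R}^2)$ satisfy $\boldsymbol{\alpha}^{\perp}(\xi)=0$ for $\xi\le 0$. For $(x^0,z)\in\mathbb{R}^2$ put $\xi:=x^0-z$ and define $$\boldsymbol{A}^{\perp}(x^0,z):=\boldsymbol{\alpha}^{\perp}(\xi),\qquad n_h:\equiv 0,\qquad E^z:\equiv 0,$$ $$\boldsymbol{u}_h^{\perp}(x^0,z):=\frac{-q_h}{m_hc^2}\boldsymbol{\alpha}^{\perp}(\xi),\qquad u_h^z:=\tfrac12\,\big|\boldsymbol{u}_h^{\perp}\big|^2,\qquad \gamma_h:=1+u_h^z .$$ Then $\gamma_h=\sqrt{1+|\boldsymbol{u}_h^\perp|^2+(u_h^z)^2}$, and, with $\beta_h^z:=u_h^z/\gamma_h$ and $\frac{d}{dx^0}:=\partial_0+\beta_h^z\partial_z$ (acting on quantities of the $h$-th fluid), these functions satisfy, for all $h$, the plane-wave Lorentz–Maxwell system $$\boldsymbol{u}_h^{\perp}=\frac{-q_h}{m_hc^2}\boldsymbol{A}^{\perp},\qquad \partial_zE^z=4\pi\sum_{j=1}^kq_jn_j,\qquad \partial_0E^z=-4\pi\sum_{j=1}^kq_jn_j\beta_j^z,$$ $$(\partial_0^2-\partial_z^2)\boldsymbol{A}^{\perp}+\frac{4\pi}{c^2}\Big[\sum_{j=1}^k\frac{q_j^2n_j}{m_j\gamma_j}\Big]\boldsymbol{A}^{\perp}=0,$$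 $$\frac{d\gamma_h}{dx^0}-\frac{q_hu_h^zE^z}{m_hc^2\gamma_h}-\frac{q_h^2\,\partial_0(|\boldsymbol{A}^{\perp}|^2)}{2\gamma_hm_h^2c^4}=0,\qquad \frac{du_h^z}{dx^0}-\frac{q_hE^z}{m_hc^2}+\frac{q_h^2\,\partial_z(|\boldsymbol{A}^{\perp}|^2)}{2\gamma_hm_h^2c^4}=0,$$ together with the asymptotic conditions: $\boldsymbol{A}^{\perp}=0$, $E^z=0$, $\boldsymbol{u}_h^{\perp}=0$, $u_h^z=0$ and $n_h=0$ at every point with $x^0\le z$.
   Context: A cold collisionless plasma made of $k$ species of particles with rest masses $m_h$ and charges $q_h$ (CGS units, $x^0=ct$, $c$ the speed of light) is considered under the plane-wave assumption that all fields depend only on $(x^0,z)$. $\partial_0=\partial/\partial x^0$, $\partial_z=\partial/\partial z$. $\boldsymbol{A}^\perp$ is the transverse ($\mathbb{R}^2$-valued) electromagnetic potential, $E^z$ the longitudinal electric field, $n_h$ the number density, $(\boldsymbol{u}_h^\perp,u_h^z)$ the space part of the dimensionless 4-velocity, $\gamma_h$ its time component and $\beta^z_h$ the longitudinal velocity in units of $c$, for the $h$-th fluid. *)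

(* Defs.v *)
From Stdlib Require Export Reals.
From Coquelicot Require Export Coquelicot.

Open Scope R_scope.

(* The transverse plane; the norm of a product in Coquelicot is
   sqrt (|v_1|^2 + |v_2|^2), so [norm] on [R2] is the Euclidean norm. *)
Definition R2 : NormedModule R_AbsRing :=
  prod_NormedModule R_AbsRing R_NormedModule R_NormedModule.

Definition sqn (v : R2) : R := norm v ^ 2.

Definition is_C2 {V : NormedModule R_AbsRing} (f : R -> V) : Prop :=
  exists f' f'' : R -> V,
    (forall x, is_derive f x (f' x)) /\
    (forall x, is_derive f' x (f'' x)) /\
    (forall x, continuous f'' x).

(* [is_d0 f x0 z l] : the partial derivative of f in x^0 at (x^0,z) exists and
   equals l; similarly [is_dz] for the partial derivative in z. *)
Definition is_d0 {V : NormedModule R_AbsRing} (f : R -> R -> V) (x0 z : R) (l : V) :=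
  is_derive (fun s : R => f s z) x0 l.

Definition is_dz {V : NormedModule R_AbsRing} (f : R -> R -> V) (x0 z : R) (l : V) :=
  is_derive (fun s : R => f x0 s) z l.

(* d/dx^0 = d_0 + beta d_z, where beta is itself a field. *)
Definition is_material_derive (beta f : R -> R -> R) (x0 z l : R) : Prop :=
  exists f0 fz : R,
    is_d0 f x0 z f0 /\ is_dz f x0 z fz /\ l = f0 + beta x0 z * fz.

(* Species are labelled by the natural numbers 1, ..., k; the values of the
   families at other labels play no role.  The derivatives occurring in each
   equation are required to exist at every point of R^2. *)
Record plane_wave_Lorentz_Maxwell (k : nat) (c : R) (m q : nat -> R)
    (A : R -> R -> R2) (E : R -> R -> R) (n : nat -> R -> R -> R)
    (uperp : nat -> R -> R -> R2) (uz gamma beta : nat -> R -> R -> R) : Prop := {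
  transverse_momentum : forall h, (1 <= h <= k)%nat -> forall x0 z,
    uperp h x0 z = scal (- q h / (m h * c ^ 2)) (A x0 z);
  gauss_law : forall x0 z,
    is_dz E x0 z (4 * PI * sum_n_m (fun j => q j * n j x0 z) 1 k);
  ampere_law : forall x0 z,
    is_d0 E x0 z (- (4 * PI * sum_n_m (fun j => q j * n j x0 z * beta j x0 z) 1 k));
  wave_equation : exists A0 Az : R -> R -> R2,
    (forall x0 z, is_d0 A x0 z (A0 x0 z)) /\
    (forall x0 z, is_dz A x0 z (Az x0 z)) /\
    forall x0 z, exists A00 Azz : R2,
      is_d0 A0 x0 z A00 /\ is_dz Az x0 z Azz /\
      plus (minus A00 Azz)
        (scal (4 * PI / c ^ 2 *
               sum_n_m (fun j => (q j) ^ 2 * n j x0 z / (m j * gamma j x0 z)) 1 k)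
              (A x0 z)) = zero;
  energy_equation : forall h, (1 <= h <= k)%nat -> forall x0 z,
    exists dgamma d0A2 : R,
      is_material_derive (beta h) (gamma h) x0 z dgamma /\
      is_d0 (fun s t => sqn (A s t)) x0 z d0A2 /\
      dgamma - q h * uz h x0 z * E x0 z / (m h * c ^ 2 * gamma h x0 z)
        - (q h) ^ 2 * d0A2 / (2 * gamma h x0 z * (m h) ^ 2 * c ^ 4) = 0;
  longitudinal_equation : forall h, (1 <= h <= k)%nat -> forall x0 z,
    exists du dzA2 : R,
      is_material_derive (beta h) (uz h) x0 z du /\
      is_dz (fun s t => sqn (A s t)) x0 z dzA2 /\
      du - q h * E x0 z / (m h * c ^ 2)
        + (q h) ^ 2 * dzA2 / (2 * gamma h x0 z * (m h) ^ 2 * c ^ 4) = 0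
}.

(* Main.v *)
Require Import Defs.
From Stdlib Require Import Reals Lra.
From Coquelicot Require Import Coquelicot.

Open Scope R_scope.

(** Every field is a function of the single variable [xi = x0 - z], for which
    [d_0 = - d_z = d/dxi]; hence [A] solves the free wave equation.  Moreover
    [gamma - u^z = 1], so [1 - beta = 1 / gamma], and the material derivative of
    a function [w xi] is [w' (1 - beta) = w' / gamma].  With [E = 0] both
    remaining equations reduce to [(u^z)' = (q / (m c^2))^2 (|alpha|^2)' / 2]. *)

Lemma sqn_coord (v : R2) : sqn v = fst v ^ 2 + snd v ^ 2.
Proof.
  unfold sqn.
  change (norm v) with (sqrt (Rabs (fst v) ^ 2 + Rabs (snd v) ^ 2)).
  rewrite !pow2_abs, pow2_sqrt; [reflexivity|].
  apply Rplus_le_le_0_compat; apply pow2_ge_0.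
Qed.

Lemma sqn_ge_0 (v : R2) : 0 <= sqn v.
Proof. apply pow2_ge_0. Qed.

Lemma sqn_zero : sqn zero = 0.
Proof. rewrite sqn_coord; simpl; unfold zero; simpl; ring. Qed.

Lemma sqn_scal (a : R) (v : R2) : sqn (scal a v) = a ^ 2 * sqn v.
Proof.
  rewrite !sqn_coord.
  change (fst (scal a v)) with (a * fst v).
  change (snd (scal a v)) with (a * snd v).
  ring.
Qed.

(** The Euclidean norm is not differentiable at the origin, so the square is differentiated as the
    polynomial [fst ^ 2 + snd ^ 2]. The projections are linear, hence each is its own differential
    in the chain rule. *)
Lemma is_derive_sqn (f : R -> R2) (x : R) (l : R2) :
  is_derive f x l ->
  is_derive (fun y => sqn (f y)) x (2 * (fst (f x) * fst l + snd (f x) * snd l)).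
Proof.
  intros Hf.
  assert (H1 : is_derive (fun y => fst (f y)) x (fst l)).
  { apply (filterdiff_comp' f (fun v : R2 => fst v) x _ (fun v : R2 => fst v) Hf).
    apply filterdiff_linear, is_linear_fst. }
  assert (H2 : is_derive (fun y => snd (f y)) x (snd l)).
  { apply (filterdiff_comp' f (fun v : R2 => snd v) x _ (fun v : R2 => snd v) Hf).
    apply filterdiff_linear, is_linear_snd. }
  apply is_derive_ext with (fun y => fst (f y) ^ 2 + snd (f y) ^ 2).
  { intros y; symmetry; apply sqn_coord. }
  replace (2 * (fst (f x) * fst l + snd (f x) * snd l))
    with (plus (INR 2 * fst l * fst (f x) ^ 1) (INR 2 * snd l * snd (f x) ^ 1))
    by (unfold plus; simpl; ring).
  apply (is_derive_plus (V := R_NormedModule));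
    apply is_derive_pow; assumption.
Qed.

Section TravellingWave.

Context {V : NormedModule R_AbsRing}.

Lemma is_d0_travelling (f : R -> V) (x0 z : R) (l : V) :
  is_derive f (x0 - z) l -> is_d0 (fun s t => f (s - t)) x0 z l.
Proof.
  intros Hf; unfold is_d0.
  (* The factor [one] is the inner derivative of [s - z] that the chain rule produces. *)
  rewrite <- (scal_one l).
  apply (is_derive_comp f (fun s => s - z)); [exact Hf|].
  unfold one; simpl; auto_derive; [exact I|ring].
Qed.

Lemma is_dz_travelling (f : R -> V) (x0 z : R) (l : V) :
  is_derive f (x0 - z) l -> is_dz (fun s t => f (s - t)) x0 z (opp l).
Proof.
  intros Hf; unfold is_dz.
  replace (opp l) with (scal (opp one) l) by apply (scal_opp_one (V := V)).
  apply (is_derive_comp f (fun t => x0 - t)); [exact Hf|].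
  unfold opp, one; simpl; auto_derive; [exact I|ring].
Qed.

End TravellingWave.

Lemma is_material_derive_travelling (beta : R -> R -> R) (f : R -> R) (x0 z l : R) :
  is_derive f (x0 - z) l ->
  is_material_derive beta (fun s t => f (s - t)) x0 z (l * (1 - beta x0 z)).
Proof.
  intros Hf; exists l, (- l); split; [|split].
  - apply (is_d0_travelling (V := R_NormedModule)); exact Hf.
  - apply (is_dz_travelling (V := R_NormedModule)); exact Hf.
  - ring.
Qed.

(** Serves to remove the charge, current and wave-equation source sums, all of whose terms carry the
    factor [n j = 0]. *)
Lemma sum_n_m_eq_0 (a : nat -> R) (n m : nat) :
  (forall j, a j = 0) -> sum_n_m a n m = 0.
Proof.
  intros Ha.
  rewrite (sum_n_m_ext a (fun _ => zero) n m Ha).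
  apply (sum_n_m_const_zero (G := R_AbelianMonoid)).
Qed.

Theorem mainTheorem1 (k : nat) (hk : (2 <= k)%nat) (c : R) (hc : 0 < c)
    (m q : nat -> R) (hm : forall h, (1 <= h <= k)%nat -> 0 < m h)
    (alpha : R -> R2) (alpha_C2 : is_C2 alpha)
    (alpha_neg : forall xi, xi <= 0 -> alpha xi = zero) :
  let A : R -> R -> R2 := fun x0 z => alpha (x0 - z) in
  let n : nat -> R -> R -> R := fun _ _ _ => 0 in
  let E : R -> R -> R := fun _ _ => 0 in
  let uperp : nat -> R -> R -> R2 :=
    fun h x0 z => scal (- q h / (m h * c ^ 2)) (alpha (x0 - z)) in
  let uz : nat -> R -> R -> R := fun h x0 z => / 2 * sqn (uperp h x0 z) in
  let gamma : nat -> R -> R -> R := fun h x0 z => 1 + uz h x0 z in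
  let beta : nat -> R -> R -> R := fun h x0 z => uz h x0 z / gamma h x0 z in
  (forall h, (1 <= h <= k)%nat -> forall x0 z,
     gamma h x0 z = sqrt (1 + sqn (uperp h x0 z) + (uz h x0 z) ^ 2)) /\
  plane_wave_Lorentz_Maxwell k c m q A E n uperp uz gamma beta /\
  (forall x0 z, x0 <= z ->
     A x0 z = zero /\ E x0 z = 0 /\
     forall h, (1 <= h <= k)%nat ->
       uperp h x0 z = zero /\ uz h x0 z = 0 /\ n h x0 z = 0).
Proof.
  intros A n E uperp uz gamma beta.
  destruct alpha_C2 as [alpha' [alpha'' [Halpha [Halpha' _]]]].
  pose (kappa h := - q h / (m h * c ^ 2)).
  assert (Huz : forall h x0 z, 0 <= uz h x0 z).
  { intros h x0 z; unfold uz; pose proof (sqn_ge_0 (uperp h x0 z)); lra. }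
  assert (Hgamma : forall h x0 z, gamma h x0 z <> 0).
  { intros h x0 z; unfold gamma; pose proof (Huz h x0 z); lra. }
  assert (Hbeta : forall h x0 z, 1 - beta h x0 z = / gamma h x0 z).
  { intros h x0 z; unfold beta.
    replace (uz h x0 z) with (gamma h x0 z - 1) by (unfold gamma; ring).
    field; apply Hgamma. }
  pose (S xi := 2 * (fst (alpha xi) * fst (alpha' xi) + snd (alpha xi) * snd (alpha' xi))).
  assert (HS : forall xi, is_derive (fun y => sqn (alpha y)) xi (S xi))
    by (intros xi; apply is_derive_sqn, Halpha).
  (* [w h] is the one-variable profile of [uz h]: by conversion [uz h] is [fun s t => w h (s - t)],
     and [gamma h] has profile [1 + w h]. This lets the travelling-wave lemmas apply directly. *)
  pose (w h xi := / 2 * sqn (scal (kappa h) (alpha xi))).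
  assert (Hw : forall h xi, is_derive (w h) xi (/ 2 * kappa h ^ 2 * S xi)).
  { intros h xi.
    apply is_derive_ext with (fun y => / 2 * kappa h ^ 2 * sqn (alpha y)).
    { intros y; unfold w; rewrite sqn_scal; apply Rmult_assoc. }
    apply (is_derive_scal (fun y => sqn (alpha y))), HS. }
  assert (Hw1 : forall h xi, is_derive (fun y => 1 + w h y) xi (/ 2 * kappa h ^ 2 * S xi)).
  { intros h xi.
    rewrite <- (Rplus_0_l (_ * S xi)).
    apply (is_derive_plus (V := R_NormedModule) (fun _ => 1) (w h)); [|apply Hw].
    apply (is_derive_const (V := R_NormedModule)). }
  split; [|split; [constructor|]].
  - intros h _ x0 z.
    (* Since [sqn (uperp h x0 z)] is twice [uz h x0 z], the radicand is the perfect square of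
       [1 + uz h x0 z]. *)
    replace (1 + sqn (uperp h x0 z) + uz h x0 z ^ 2) with (gamma h x0 z ^ 2)
      by (unfold gamma, uz; field).
    rewrite sqrt_pow2; [reflexivity|].
    unfold gamma; pose proof (Huz h x0 z); lra.
  - reflexivity.
  - intros x0 z.
    rewrite sum_n_m_eq_0 by (intros j; apply Rmult_0_r).
    rewrite Rmult_0_r.
    apply (is_derive_const (V := R_NormedModule) 0 z).
  - intros x0 z.
    rewrite sum_n_m_eq_0 by (intros j; unfold n; ring).
    rewrite Rmult_0_r, Ropp_0.
    apply (is_derive_const (V := R_NormedModule) 0 x0).
  - exists (fun x0 z => alpha' (x0 - z)), (fun x0 z => opp (alpha' (x0 - z))).
    split; [intros x0 z; apply is_d0_travelling, Halpha|].
    split; [intros x0 z; apply is_dz_travelling, Halpha|].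
    intros x0 z.
    (* Each derivative in [z] contributes one sign; the two signs cancel, so both second derivatives
       agree. *)
    exists (alpha'' (x0 - z)), (opp (opp (alpha'' (x0 - z)))).
    split; [apply is_d0_travelling, Halpha'|].
    split.
    { apply (is_dz_travelling (fun xi => opp (alpha' xi))).
      apply is_derive_opp, Halpha'. }
    (* The inverse stays opaque to [ring], so the term vanishes for every label [j], including those
       where [m j] may be zero. *)
    rewrite sum_n_m_eq_0 by (intros j; unfold n, Rdiv; ring).
    rewrite Rmult_0_r, opp_opp.
    transitivity (plus (zero : R2) zero); [|apply plus_zero_l].
    f_equal; [apply (minus_eq_zero (G := R2))|apply (scal_zero_l (V := R2))].
  - intros h Hh x0 z.
    exists (/ 2 * kappa h ^ 2 * S (x0 - z) * (1 - beta h x0 z)), (S (x0 - z)).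
    split; [apply (is_material_derive_travelling _ _ _ _ _ (Hw1 h (x0 - z)))|].
    split.
    { apply (is_d0_travelling (V := R_NormedModule) (fun y => sqn (alpha y))), HS. }
    rewrite Hbeta; unfold kappa, E.
    specialize (Hgamma h x0 z); specialize (hm h Hh).
    (* Both terms equal [kappa h ^ 2 * S / (2 * gamma h)], because [kappa h ^ 2] is
       [q h ^ 2 / (m h ^ 2 * c ^ 4)]. *)
    field; repeat split; try assumption; apply Rgt_not_eq; assumption.
  - intros h Hh x0 z.
    (* The material derivative is that of [gamma h], which differs from [uz h] by a constant; the
       sign of the [z]-derivative offsets the plus sign in this equation. *)
    exists (/ 2 * kappa h ^ 2 * S (x0 - z) * (1 - beta h x0 z)), (- S (x0 - z)).
    split; [apply (is_material_derive_travelling _ _ _ _ _ (Hw h (x0 - z)))|].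
    split.
    { apply (is_dz_travelling (V := R_NormedModule) (fun y => sqn (alpha y))), HS. }
    rewrite Hbeta; unfold kappa, E.
    specialize (Hgamma h x0 z); specialize (hm h Hh).
    field; repeat split; try assumption; apply Rgt_not_eq; assumption.
  - intros x0 z Hz.
    assert (H0 : alpha (x0 - z) = zero) by (apply alpha_neg; lra).
    split; [exact H0|split; [reflexivity|]].
    intros h _.
    assert (Hu : uperp h x0 z = zero)
      by (unfold uperp; rewrite H0; apply (scal_zero_r (V := R2))).
    split; [exact Hu|split; [|reflexivity]].
    unfold uz; rewrite Hu, sqn_zero; ring.
Qed.
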